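(* Let $(\mathfrak g,[\cdot,\cdot]_{\mathfrak g})$ and $(\mathfrak h,[\cdot,\cdot]_{\mathfrak h})$ be Leibniz algebras, $(\mathfrak h,\rho^L,\rho^R)$ a Leibniz $\mathfrak g$-representation, and $H:\mathfrak g\to\mathfrak h$ a crossed homomorphism. A finite order deformation $H_t=\sum_{i=0}^Nt^iH_i$ of $H$ (of order $N$) extends to a deformation of the next order $N+1$ if and only if the obstruction class $[Ob_{H_t}]\in\mathcal H^2_H(\mathfrak g,\mathfrak h)$ vanishes.
   Context: All vector spaces are over a field $\mathbf k$ of characteristic $0$. A Leibniz algebra is a vector space $\mathfrak g$ with a bilinear bracket satisfying $[x,[y,z]_{\mathfrak g}]_{\mathfrak g}=[[x,y]_{\mathfrak g},z]_{\mathfrak g}+[y,[x,z]_{\mathfrak g}]_{\mathfrak g}$ for all $x,y,z$. A representation of $\mathfrak g$ is a vector space $V$ with linear maps $\rho^L,\rho^R:\mathfrak g\to \mathrm{End}(V)$ such that for all $x,y\in\mathfrak g$: $\rho^L([x,y]_{\mathfrak g})=\rho^L(x)\rho^L(y)-\rho^L(y)\rho^L(x)$; $\rho^R([x,y]_{\mathfrak g})=\rho^L(x)\rho^R(y)-\rho^R(y)\rho^L(x)$; $\rho^R([x,y]_{\mathfrak g})=\rho^L(x)\rho^R(y)+\rho^R(y)\rho^R(x)$. A Leibniz $\mathfrak g$-representation is a Leibniz algebra $\mathfrak h$ with linear maps $\rho^L,\rho^R:\mathfrak g\to\mathrm{End}(\mathfrak h)$ making $(\mathfrak h,\rho^L,\rho^R)$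 a representation of $\mathfrak g$ and such that for all $h,k\in\mathfrak h$, $x\in\mathfrak g$: $\rho^L(x)[h,k]_{\mathfrak h}=[\rho^L(x)h,k]_{\mathfrak h}+[h,\rho^L(x)k]_{\mathfrak h}$; $[h,\rho^R(x)k]_{\mathfrak h}=\rho^R(x)[h,k]_{\mathfrak h}+[k,\rho^R(x)h]_{\mathfrak h}$; $[h,\rho^L(x)k]_{\mathfrak h}=[\rho^R(x)h,k]_{\mathfrak h}+\rho^L(x)[h,k]_{\mathfrak h}$. A crossed homomorphism is a linear map $H:\mathfrak g\to\mathfrak h$ with $H([x,y]_{\mathfrak g})=\rho^L(x)H(y)+\rho^R(y)H(x)+[H(x),H(y)]_{\mathfrak h}$ for all $x,y\in\mathfrak g$. The same definitions are used over the base rings $\mathbf k[[t]]/(t^{N+1})$. Cohomology of $H$: put $\rho^L_H(x)h=\rho^L(x)h+[H(x),h]_{\mathfrak h}$, $\rho^R_H(x)h=\rho^R(x)h+[h,H(x)]_{\mathfrak h}$, and $C^n(\mathfrak g,\mathfrak h)=\mathrm{Hom}(\mathfrak g^{\otimes n},\mathfrak h)$ for $n\ge0$. The cohomology $\mathcal H^*_H(\mathfrak g,\mathfrak h)$ of $H$ is that of the complex $(C^*(\mathfrak g,\mathfrak h),d_H)$ with $d_H f=(-1)^{n-1}\delta_{\mathrm{Leib}}f$ for $f\in C^n(\mathfrak g,\mathfrak h)$, where $$(\delta_{\mathrm{Leib}}f)(x_1,\dots,x_{n+1})=\sum_{i=1}^n(-1)^{i+1}\rho^L_H(x_i)f(x_1,\dots,\hat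 x_i,\dots,x_{n+1})+(-1)^{n+1}\rho^R_H(x_{n+1})f(x_1,\dots,x_n)$$ $$+\sum_{1\le i<j\le n+1}(-1)^if(x_1,\dots,\hat x_i,\dots,x_{j-1},[x_i,x_j]_{\mathfrak g},x_{j+1},\dots,x_{n+1}).$$ $\mathfrak g[[t]]/(t^{N+1})$ and $\mathfrak h[[t]]/(t^{N+1})$ are Leibniz algebras over $\mathbf k[[t]]/(t^{N+1})$, the latter a Leibniz representation of the former, with structures extended linearly in $t$. A deformation of $H$ of order $N$ is a finite sum $H_t=\sum_{i=0}^Nt^iH_i$ with $H_i:\mathfrak g\to\mathfrak h$ linear and $H_0=H$, such that $H_t$ is a crossed homomorphism from $\mathfrak g[[t]]/(t^{N+1})$ to $\mathfrak h[[t]]/(t^{N+1})$. It extends to a deformation of next order (is extensible) if there is a linear map $H_{N+1}:\mathfrak g\to\mathfrak h$ such that $H_t+t^{N+1}H_{N+1}$ is a deformation of $H$ of order $N+1$. For linear maps $A,B:\mathfrak g\to\mathfrak h$ put $\widehat{[\![A,B]\!]}(x,y)=[A(x),B(y)]_{\mathfrak h}+[B(x),A(y)]_{\mathfrak h}$, and define $$Ob_{H_t}=-\tfrac12\sum_{i+j=N+1,\ i,j\ge1}\widehat{[\![H_i,H_j]\!]}\in C^2(\mathfrak g,\mathfrak h),\quad\text{i.e. } Ob_{H_t}(x,y)=-\sum_{i+j=N+1,\ i,j\ge1}[H_i(x),H_j(y)]_{\mathfrak h}.$$ This is a $2$-cocycle for $d_H$; its class $[Ob_{H_t}]\in\mathcal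 H^2_H(\mathfrak g,\mathfrak h)$ is the obstruction class. *)

(* Defs.v *)
From HB Require Import structures.
From mathcomp Require Import all_boot all_order all_algebra.
From mathcomp Require Import boolp functions.

Set Implicit Arguments.
Unset Strict Implicit.
Unset Printing Implicit Defensive.

Import GRing.Theory.
Local Open Scope ring_scope.
Local Open Scope quotient_scope.

Reserved Notation "⟦ x , y ⟧" (at level 0, x, y at level 99,
  format "⟦ x ,  y ⟧").

Record leibnizAlg (R : comNzRingType) := LeibnizAlg {
  leibniz_mod :> lmodType R;
  leibniz_br : {bilinear leibniz_mod -> leibniz_mod -> leibniz_mod};
  leibniz_id : forall x y z, leibniz_br x (leibniz_br y z) =
    leibniz_br (leibniz_br x y) z + leibniz_br y (leibniz_br x z)
}.

Notation "⟦ x , y ⟧" := (leibniz_br _ x y) : ring_scope.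

(* Linear maps g -> End(V) are given in uncurried form, as bilinear maps. *)
Record is_representation (R : comNzRingType) (g : leibnizAlg R)
    (V : lmodType R) (rhoL rhoR : {bilinear g -> V -> V}) : Prop := {
  rep_LL : forall x y v,
    rhoL ⟦x, y⟧ v = rhoL x (rhoL y v) - rhoL y (rhoL x v);
  rep_LR : forall x y v,
    rhoR ⟦x, y⟧ v = rhoL x (rhoR y v) - rhoR y (rhoL x v);
  rep_RR : forall x y v,
    rhoR ⟦x, y⟧ v = rhoL x (rhoR y v) + rhoR y (rhoR x v)
}.

Record leibnizRep (R : comNzRingType) (g : leibnizAlg R) := LeibnizRep {
  rep_alg :> leibnizAlg R;
  rhoL : {bilinear g -> rep_alg -> rep_alg};
  rhoR : {bilinear g -> rep_alg -> rep_alg};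
  rep_axiom : is_representation rhoL rhoR;
  rep_brL : forall x (h k : rep_alg),
    rhoL x ⟦h, k⟧ = ⟦rhoL x h, k⟧ + ⟦h, rhoL x k⟧;
  rep_brR : forall x (h k : rep_alg),
    ⟦h, rhoR x k⟧ = rhoR x ⟦h, k⟧ + ⟦k, rhoR x h⟧;
  rep_brLR : forall x (h k : rep_alg),
    ⟦h, rhoL x k⟧ = ⟦rhoR x h, k⟧ + rhoL x ⟦h, k⟧
}.

Definition crossed_hom (R : comNzRingType) (g : leibnizAlg R)
    (h : leibnizRep g) (H : {linear g -> h}) : Prop :=
  forall x y,
    H ⟦x, y⟧ = rhoL h x (H y) + rhoR h y (H x) + ⟦H x, H y⟧.

Section Cohomology.
Variables (K : fieldType) (g : leibnizAlg K) (h : leibnizRep g).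
Variable (H : {linear g -> h}).

(* An n-cochain, i.e. a linear map g^{(x) n} -> h, is a multilinear function
   of x_0, ..., x_{n-1}; for n = 0 it is an element of h. *)
Definition multilinear n (f : ('I_n -> g) -> h) : Prop :=
  forall (i : 'I_n) (x : 'I_n -> g), linear (fun y => f [eta x with i |-> y]).

Definition rhoLH (x : g) (u : h) : h := rhoL h x u + ⟦H x, u⟧.
Definition rhoRH (x : g) (u : h) : h := rhoR h x u + ⟦u, H x⟧.

(* Arguments are numbered from 0, so the usual signs (-1)^{i+1} and (-1)^i of
   the x_i-terms become (-1)^i and (-1)^{i+1}. *)
Definition leibniz_delta n (f : ('I_n -> g) -> h) (x : 'I_n.+1 -> g) : h :=
  \sum_(i < n) (-1) ^+ i *:
      rhoLH (x (widen_ord (leqnSn n) i))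
            (f (fun k => x (lift (widen_ord (leqnSn n) i) k)))
  + (-1) ^+ n.+1 *: rhoRH (x ord_max) (f (fun k => x (lift ord_max k)))
  + \sum_(i < n.+1) \sum_(j < n.+1 | (i < j)%N) (-1) ^+ i.+1 *:
      f (fun k => if lift i k == j then ⟦x i, x j⟧ else x (lift i k)).

(* (-1)^{n+1} = (-1)^{n-1}; this form also makes sense for n = 0. *)
Definition dH n (f : ('I_n -> g) -> h) : ('I_n.+1 -> g) -> h :=
  fun x => (-1) ^+ n.+1 *: leibniz_delta f x.

Definition is_cocycle n (f : ('I_n -> g) -> h) : Prop :=
  multilinear f /\ dH f = 0.

Definition is_coboundary n : (('I_n -> g) -> h) -> Prop :=
  match n with
  | 0 => fun f => f = 0
  | m.+1 => fun f => exists2 c : ('I_m -> g) -> h, multilinear c & dH c = f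
  end.

Lemma rhoLH_linear x : linear (rhoLH x).
Proof.
move=> a u v; rewrite /rhoLH !linearPr scalerDr !addrA; congr (_ + _).
by rewrite addrAC.
Qed.

Lemma rhoRH_linear x : linear (rhoRH x).
Proof.
move=> a u v; rewrite /rhoRH linearPr linearPl scalerDr !addrA.
by congr (_ + _); rewrite addrAC.
Qed.

Lemma dH_linear n : linear (@dH n).
Proof.
move=> a f f'; apply/funext => x.
change (dH (a *: f + f') x = a *: dH f x + dH f' x); rewrite /dH !scalerA [a * _]mulrC -!scalerA.
rewrite -scalerDr; congr (_ *: _); rewrite /leibniz_delta.
rewrite 2![in RHS]scalerDr [RHS]addrACA.
rewrite [X in _ = X + _]addrACA; congr (_ + _ + _).
- rewrite scaler_sumr -big_split; apply: eq_bigr => i _ /=.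
  by rewrite rhoLH_linear scalerDr !scalerA [a * _]mulrC.
- by rewrite rhoRH_linear scalerDr !scalerA [a * _]mulrC.
rewrite scaler_sumr -big_split; apply: eq_bigr => i _ /=.
rewrite scaler_sumr -big_split; apply: eq_bigr => j _ /=.
by rewrite [X in _ *: X = _]/= scalerDr !scalerA [a * _]mulrC.
Qed.

Lemma multilinearP n a (f f' : ('I_n -> g) -> h) :
  multilinear f -> multilinear f' -> multilinear (a *: f + f').
Proof.
move=> lf lf' i x b u v; rewrite !fctE lf lf' !scalerDr !scalerA [a * b]mulrC.
by rewrite addrACA.
Qed.

Lemma multilinear0 n : multilinear (0 : ('I_n -> g) -> h).
Proof. by move=> i x b u v /=; rewrite scaler0 addr0. Qed.

Lemma dH0 n : dH (0 : ('I_n -> g) -> h) = 0.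
Proof. by have := dH_linear (-1) (0 : ('I_n -> g) -> h) 0; rewrite !scaleN1r !addNr. Qed.

Definition cocycle_pred n : {pred ('I_n -> g) -> h} :=
  fun f => `[< is_cocycle f >].

Lemma cocycle_zmod_closed n : zmod_closed (@cocycle_pred n).
Proof.
split=> [|f f' /asboolP[lf df] /asboolP[lf' df']]; apply/asboolP.
  by split; [exact: multilinear0|exact: dH0].
by rewrite addrC -scaleN1r; split;
  [exact: multilinearP|rewrite dH_linear df df' scaler0 addr0].
Qed.

HB.instance Definition _ n :=
  GRing.isZmodClosed.Build _ (@cocycle_pred n) (@cocycle_zmod_closed n).

Record cocycle n := Cocycle {
  cocycle_fun :> ('I_n -> g) -> h;
  _ : cocycle_fun \in @cocycle_pred n
}.
HB.instance Definition _ n := [isSub for @cocycle_fun n].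
HB.instance Definition _ n := [Choice of cocycle n by <:].
HB.instance Definition _ n := [SubChoice_isSubZmodule of cocycle n by <:].

(* The coboundaries, as a subgroup of the group of n-cocycles. *)
Definition coboundary_pred n : {pred cocycle n} :=
  fun z => `[< is_coboundary (cocycle_fun z) >].

Lemma coboundary_zmod_closed n : zmod_closed (@coboundary_pred n).
Proof.
split; first apply/asboolP.
  by case: n => [|n] //=; exists 0; [exact: multilinear0|exact: dH0].
case: n => [|n] z z' /asboolP /= zB /asboolP /= z'B; apply/asboolP => /=.
  by rewrite zB z'B subr0.
case: zB => c lc <-; case: z'B => c' lc' <-; exists (-1 *: c' + c).
  exact: multilinearP.
by rewrite dH_linear scaleN1r addrC.
Qed.

HB.instance Definition _ n :=
  GRing.isZmodClosed.Build _ (@coboundary_pred n) (@coboundary_zmod_closed n).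

Definition cohomology n : zmodType := Quotient.quot (@coboundary_pred n).

Definition cohomology_class n (f : ('I_n -> g) -> h) (fZ : is_cocycle f) :
    cohomology n :=
  \pi_(Quotient.quot (@coboundary_pred n)) (Cocycle (asboolT fZ)).

End Cohomology.

Section Truncation.
Variables (K : fieldType) (N : nat).
Implicit Types V : lmodType K.

(* V[[t]]/(t^{N+1}): the finite function v stands for \sum_(i <= N) t^i v_i.
   This is an alias of {ffun _ -> _} because it is given a module structure
   over K[[t]]/(t^{N+1}) below. *)
Definition trunc (V : zmodType) := {ffun 'I_N.+1 -> V}.
HB.instance Definition _ (V : zmodType) := GRing.Zmodule.on (trunc V).

(* The coefficients of (\sum_i t^i u_i, \sum_j t^j v_j) |-> f(u, v), f being
   extended t-bilinearly; total degrees above N vanish. *)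
Definition conv (U V : Type) (W : zmodType) (f : U -> V -> W) (u : 'I_N.+1 -> U)
    (v : 'I_N.+1 -> V) : trunc W :=
  [ffun k : 'I_N.+1 =>
    \sum_(i < N.+1) \sum_(j < N.+1 | (i + j)%N == k) f (u i) (v j)].

Definition conv3 (W : zmodType) (k : nat) (F : 'I_N.+1 -> 'I_N.+1 -> 'I_N.+1 -> W) : W :=
  \sum_(i < N.+1) \sum_(j < N.+1) \sum_(l < N.+1 | (i + j + l)%N == k) F i j l.

Lemma conv3_swap12 (W : zmodType) k (F : _ -> _ -> _ -> W) :
  conv3 k F = conv3 k (fun j i l => F i j l).
Proof.
rewrite /conv3 exchange_big; apply: eq_bigr => i _; apply: eq_bigr => j _.
by apply: eq_bigl => l; rewrite [(j + i)%N]addnC.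
Qed.

Lemma conv3_swap23 (W : zmodType) k (F : _ -> _ -> _ -> W) :
  conv3 k F = conv3 k (fun i l j => F i j l).
Proof.
rewrite /conv3; apply: eq_bigr => i _; rewrite (exchange_big_dep predT) //=.
by apply: eq_bigr => l _; apply: eq_bigl => j; rewrite addnAC.
Qed.

Lemma eq_conv3 (W : zmodType) k (F F' : _ -> _ -> _ -> W) :
  (forall i j l, F i j l = F' i j l) -> conv3 k F = conv3 k F'.
Proof.
move=> e; apply: eq_bigr => i _; apply: eq_bigr => j _.
by apply: eq_bigr => l _.
Qed.

Lemma conv3D (W : zmodType) k (F F' : _ -> _ -> _ -> W) :
  conv3 k F + conv3 k F' = conv3 k (fun i j l => F i j l + F' i j l).
Proof.
rewrite -big_split; apply: eq_bigr => i _; rewrite -big_split.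
by apply: eq_bigr => j _; rewrite -big_split.
Qed.

Lemma conv3N (W : zmodType) k (F : _ -> _ -> _ -> W) :
  - conv3 k F = conv3 k (fun i j l => - F i j l).
Proof.
rewrite -sumrN; apply: eq_bigr => i _; rewrite -sumrN.
by apply: eq_bigr => j _; rewrite -sumrN.
Qed.

Lemma convC (U V : Type) (W : zmodType) (f : U -> V -> W) u v :
  conv f u v = conv (fun y x => f x y) v u.
Proof.
apply/ffunP => k; rewrite !ffunE (exchange_big_dep predT) //=.
by apply: eq_bigr => j _; apply: eq_bigl => i; rewrite addnC.
Qed.

Lemma conv_convr (S T U : Type) (W W' : zmodType) (f : U -> W -> W') (g : S -> T -> W) u x y (k : 'I_N.+1) :
  (forall a, zmod_morphism (f a)) ->
  conv f u (conv g x y) k = conv3 k (fun i j l => f (u i) (g (x j) (y l))).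
Proof.
move=> fD; rewrite ffunE; apply: eq_bigr => i _.
pose fA : {additive W -> W'} := HB.pack (f (u i))
  (GRing.isZmodMorphism.Build _ _ _ (fD (u i))).
transitivity (\sum_(m < N.+1 | (i + m == k)%N)
    \sum_(j < N.+1) \sum_(l < N.+1 | (j + l == m)%N) f (u i) (g (x j) (y l))).
  apply: eq_bigr => m _; rewrite ffunE -[f (u i)]/(fA : _ -> _) raddf_sum.
  by apply: eq_bigr => j _; rewrite raddf_sum.
rewrite exchange_big; apply: eq_bigr => j _.
rewrite (exchange_big_dep predT) //= [RHS]big_mkcond; apply: eq_bigr => l _.
case: ifP => [/eqP e|ne]; last first.
  rewrite big_pred0 // => m; apply/andP => -[/eqP e1 /eqP e2].
  by rewrite -addnA e2 e1 eqxx in ne.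
have lt_m : (j + l < N.+1)%N.
  by rewrite (leq_ltn_trans _ (ltn_ord k)) // -e -addnA leq_addl.
rewrite (big_pred1 (Ordinal lt_m)) // => m /=.
apply/andP/eqP => [[_ /eqP e2]|->]; first by apply/val_inj; rewrite /= e2.
by rewrite /= eqxx addnA e.
Qed.

Lemma conv_convl (S T U : Type) (W W' : zmodType) (f : W -> U -> W') (g : S -> T -> W) u x y (k : 'I_N.+1) :
  (forall a, zmod_morphism (f^~ a)) ->
  conv f (conv g x y) u k = conv3 k (fun i j l => f (g (x i) (y j)) (u l)).
Proof.
move=> fD; rewrite convC (conv_convr (f := fun y x => f x y)) //.
by rewrite conv3_swap12 conv3_swap23.
Qed.

(* The ring K[[t]]/(t^{N+1}), as K[X]/(X^{N+1}). *)
Local Notation KN := {poly %/ ('X^(N.+1) : {poly K})}.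

Definition trunc_scale V (p : KN) (v : trunc V) : trunc V :=
  conv *:%R (fun i : 'I_N.+1 => (p : {poly K})`_i) v.

Lemma coef_truncM (p q : KN) (k : 'I_N.+1) :
  ((p * q : KN) : {poly K})`_k =
    conv *%R (fun i : 'I_N.+1 => (p : {poly K})`_i)
      (fun i : 'I_N.+1 => (q : {poly K})`_i) k.
Proof.
have modE (r : {poly K}) :
    (Pdiv.CommonRing.rmodp r (mk_monic 'X^(N.+1)))`_k = r`_k.
  rewrite mk_monic_Xn /=.
  rewrite [in RHS](Pdiv.RingMonic.rdivp_eq (monicXn _ N.+1) r) coefD coefMXn.
  by rewrite ltn_ord add0r.
rewrite poly_of_qpolyM modE.
rewrite coefM ffunE.
rewrite (@big_ord_widen _ _ _ k.+1 N.+1 (fun i => (p : {poly K})`_i * (q : {poly K})`_(k - i))) //.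
rewrite big_mkcond; apply: eq_bigr => i _ /=; rewrite ltnS; case: leqP => ik.
  have lt_m : (k - i < N.+1)%N by rewrite (leq_ltn_trans (leq_subr _ _)).
  rewrite (big_pred1 (Ordinal lt_m)) // => m /=.
  apply/eqP/eqP => [e|->]; last by rewrite /= subnKC.
  by apply/val_inj; rewrite /= -e addKn.
rewrite big_pred0 // => m; apply/eqP => e.
by move: ik; rewrite -e ltnNge leq_addr.
Qed.

Lemma trunc_scalerA V (p q : KN) (v : trunc V) :
  trunc_scale p (trunc_scale q v) = trunc_scale (p * q) v.
Proof.
apply/ffunP => k; rewrite /trunc_scale conv_convr; last first.
  by move=> a x y; rewrite scalerBr.
have -> : (fun i : 'I_N.+1 => ((p * q : KN) : {poly K})`_i) =
   conv *%R (fun i : 'I_N.+1 => (p : {poly K})`_i)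
      (fun i : 'I_N.+1 => (q : {poly K})`_i).
  by apply/funext => i; rewrite coef_truncM.
rewrite conv_convl; last by move=> a x y; rewrite scalerBl.
by apply: eq_conv3 => i j l; rewrite scalerA.
Qed.

Lemma trunc_scale1r V : left_id (1 : KN) (@trunc_scale V).
Proof.
move=> v; apply/ffunP => k; rewrite ffunE big_ord_recl [X in _ + X]big1 ?addr0.
  rewrite (big_pred1 k) => [|j]; last by rewrite /= add0n.
  by rewrite /= polyseqC oner_eq0 /= scale1r.
move=> i _; rewrite big1 // => j _.
by rewrite /= polyseqC oner_eq0 /= nth_nil scale0r.
Qed.

Lemma trunc_scalerDr V : right_distributive (@trunc_scale V) +%R.
Proof.
move=> p u v; apply/ffunP => k; rewrite !ffunE -big_split.
apply: eq_bigr => i _; rewrite -big_split; apply: eq_bigr => j _ /=.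
by rewrite ffunE scalerDr.
Qed.

Lemma trunc_scalerDl V (v : trunc V) :
  {morph (@trunc_scale V)^~ v : p q / p + q}.
Proof.
move=> p q; apply/ffunP => k; rewrite !ffunE -big_split.
apply: eq_bigr => i _; rewrite -big_split; apply: eq_bigr => j _ /=.
by rewrite coefD scalerDl.
Qed.

HB.instance Definition _ V := GRing.Zmodule_isLmodule.Build KN (trunc V)
  (@trunc_scalerA V) (@trunc_scale1r V) (@trunc_scalerDr V) (@trunc_scalerDl V).

Lemma trunc_scaleE V (p : KN) (v : trunc V) :
  p *: v = conv *:%R (fun i : 'I_N.+1 => (p : {poly K})`_i) v.
Proof. by []. Qed.

(* The K[[t]]/(t^{N+1})-linear map \sum_i t^i F_i. *)
Definition trunc_hom (V W : lmodType K) (F : 'I_N.+1 -> {linear V -> W}) (v : trunc V) :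
    trunc W :=
  conv (fun (f : {linear V -> W}) x => f x) F v.

Lemma conv_morphr (S : Type) (V W : zmodType) (f : S -> V -> W) u :
  (forall a, zmod_morphism (f a)) ->
  {morph (fun v : trunc V => conv f u v) : v v' / v + v'}.
Proof.
move=> fB v v'; apply/ffunP => k; rewrite !ffunE -big_split.
apply: eq_bigr => i _; rewrite -big_split; apply: eq_bigr => j _ /=.
pose fA : {additive V -> W} := HB.pack (f (u i))
  (GRing.isZmodMorphism.Build _ _ _ (fB (u i))).
by rewrite ffunE -[f (u i)]/(fA : _ -> _) raddfD.
Qed.

Lemma conv_morphl (S : Type) (V W : zmodType) (f : V -> S -> W) u :
  (forall a, zmod_morphism (f^~ a)) ->
  {morph (fun v : trunc V => conv f v u) : v v' / v + v'}.
Proof.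
move=> fB v v'; rewrite !(convC f).
exact: (conv_morphr (f := fun y x => f x y)).
Qed.

Lemma conv_scaler (S : Type) (V W : lmodType K) (f : S -> V -> W) u :
  (forall a, linear (f a)) -> forall (p : KN) (v : trunc V),
  conv f u (p *: v) = p *: conv f u v.
Proof.
move=> fL p v.
have fB a : zmod_morphism (f a) by exact: zmod_morphism_linear (fL a).
apply/ffunP => k; rewrite !trunc_scaleE conv_convr // conv_convr; last first.
  by move=> a x y; rewrite scalerBr.
rewrite conv3_swap12; apply: eq_conv3 => i j l.
by have := scalable_linear (fL (u j)) p`_i (v l).
Qed.

Lemma conv_scalel (S : Type) (V W : lmodType K) (f : V -> S -> W) u :
  (forall a, linear (f^~ a)) -> forall (p : KN) (v : trunc V),
  conv f (p *: v) u = p *: conv f v u.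
Proof.
move=> fL p v; rewrite !(convC f).
exact: (conv_scaler (f := fun y x => f x y)).
Qed.

Lemma trunc_hom_linear (V W : lmodType K) (F : 'I_N.+1 -> {linear V -> W}) :
  linear (trunc_hom F).
Proof.
move=> p u v; rewrite /trunc_hom conv_morphr ?conv_scaler //.
- by move=> f a x y; rewrite linearP.
- by move=> f x y; rewrite linearB.
Qed.
HB.instance Definition _ (V W : lmodType K) F :=
  GRing.isLinear.Build KN (trunc V) (trunc W) *:%R (@trunc_hom V W F)
    (trunc_hom_linear F).

Definition trunc_bil (U V W : lmodType K) (f : {bilinear U -> V -> W})
    (u : trunc U) (v : trunc V) : trunc W := conv f u v.

Lemma trunc_bil_bilinear (U V W : lmodType K) (f : {bilinear U -> V -> W}) :
  bilinear_for *:%R *:%R (@trunc_bil U V W f : trunc U -> trunc V -> trunc W).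
Proof.
split=> [v|u] p x y; rewrite /trunc_bil.
  rewrite conv_morphl ?conv_scalel // => a b c; first by move=> d; rewrite linearPl.
  by rewrite linearBl.
rewrite conv_morphr ?conv_scaler // => a b c; first by move=> d; rewrite linearPr.
by rewrite linearBr.
Qed.
HB.instance Definition _ (U V W : lmodType K) f :=
  bilinear_isBilinear.Build KN (trunc U) (trunc V) (trunc W) *:%R *:%R
    (@trunc_bil U V W f) (trunc_bil_bilinear f).

Lemma convrE (U V V' W W' : lmodType K) (f : {bilinear U -> W -> W'})
    (b : {bilinear V -> V' -> W}) (u : trunc U) (x : trunc V) (y : trunc V') k :
  trunc_bil f u (trunc_bil b x y) k =
    conv3 k (fun i j l => f (u i) (b (x j) (y l))).
Proof. by rewrite conv_convr // => a c d; rewrite linearBr. Qed.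

Lemma convlE (U V V' W W' : lmodType K) (f : {bilinear W -> U -> W'})
    (b : {bilinear V -> V' -> W}) (u : trunc U) (x : trunc V) (y : trunc V') k :
  trunc_bil f (trunc_bil b x y) u k =
    conv3 k (fun i j l => f (b (x i) (y j)) (u l)).
Proof. by rewrite conv_convl // => a c d; rewrite linearBl. Qed.

Lemma truncDE (V : zmodType) (u v : trunc V) k : (u + v) k = u k + v k.
Proof. by rewrite ffunE. Qed.

Lemma truncNE (V : zmodType) (u : trunc V) k : (- u) k = - u k.
Proof. by rewrite ffunE. Qed.

Lemma trunc_leibniz_id (g : leibnizAlg K) (x y z : trunc g) (br := trunc_bil (@leibniz_br K g)) :
  br x (br y z) = br (br x y) z + br y (br x z).
Proof.
apply/ffunP => k; rewrite truncDE /br !convrE convlE.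
rewrite [X in _ = _ + X]conv3_swap12 conv3D; apply: eq_conv3 => i j l.
exact: leibniz_id.
Qed.

Definition trunc_leibniz (g : leibnizAlg K) : leibnizAlg KN :=
  @LeibnizAlg KN (trunc g) (trunc_bil (@leibniz_br K g)) (@trunc_leibniz_id g).

Section TruncRep.
Variables (g : leibnizAlg K) (h : leibnizRep g).
Let gN := trunc_leibniz g.
Let hN := trunc_leibniz h.

Let rhoLN : {bilinear gN -> hN -> hN} := trunc_bil (rhoL h).
Let rhoRN : {bilinear gN -> hN -> hN} := trunc_bil (rhoR h).

Lemma trunc_is_representation : is_representation rhoLN rhoRN.
Proof.
have [LL LR RR] := rep_axiom h.
split=> x y v; apply/ffunP => k; rewrite truncDE ?truncNE !convrE convlE.
- rewrite conv3N [X in _ + X]conv3_swap12 conv3D.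
  by apply: eq_conv3 => i j l; exact: LL.
- rewrite conv3N [X in _ + X]conv3_swap12 conv3D.
  by apply: eq_conv3 => i j l; exact: LR.
- rewrite [X in _ + X]conv3_swap12 conv3D.
  by apply: eq_conv3 => i j l; exact: RR.
Qed.

Lemma trunc_rep_brL x (u v : hN) :
  rhoLN x ⟦u, v⟧ = ⟦rhoLN x u, v⟧ + ⟦u, rhoLN x v⟧.
Proof.
apply/ffunP => k; rewrite truncDE !convrE convlE.
rewrite [X in _ + X]conv3_swap12 conv3D.
by apply: eq_conv3 => i j l; exact: rep_brL.
Qed.

Lemma trunc_rep_brR x (u v : hN) :
  ⟦u, rhoRN x v⟧ = rhoRN x ⟦u, v⟧ + ⟦v, rhoRN x u⟧.
Proof.
apply/ffunP => k; rewrite truncDE !convrE.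
rewrite [X in X + _]conv3_swap12 [X in _ + X]conv3_swap12.
rewrite [X in _ + X]conv3_swap23 [X in _ + X]conv3_swap12.
rewrite conv3D; apply: eq_conv3 => i j l; exact: rep_brR.
Qed.

Lemma trunc_rep_brLR x (u v : hN) :
  ⟦u, rhoLN x v⟧ = ⟦rhoRN x u, v⟧ + rhoLN x ⟦u, v⟧.
Proof.
apply/ffunP => k; rewrite truncDE !convrE convlE.
rewrite [X in X + _]conv3_swap12 [X in _ + X]conv3_swap12 conv3D.
by apply: eq_conv3 => i j l; exact: rep_brLR.
Qed.

Definition trunc_rep : leibnizRep gN :=
  @LeibnizRep KN gN hN rhoLN rhoRN trunc_is_representation
    trunc_rep_brL trunc_rep_brR trunc_rep_brLR.

End TruncRep.

Definition trunc_cst (V : zmodType) (v : V) : trunc V :=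
  [ffun i => if i == ord0 then v else 0].

Lemma conv_cstr (S : Type) (V W : zmodType) (f : S -> V -> W) u v k :
  (forall a, f a 0 = 0) -> conv f u (trunc_cst v) k = f (u k) v.
Proof.
move=> f0; rewrite ffunE (bigD1 k) //= [X in _ + X]big1 ?addr0.
  rewrite (big_pred1 ord0) ?ffunE // => j /=.
  by rewrite -{2}[val k]addn0 eqn_add2l.
move=> i ik; rewrite big1 // => j /eqP e; rewrite ffunE; case: eqP => // j0.
by case/negP: ik; apply/eqP/val_inj; rewrite /= -e j0 addn0.
Qed.

Lemma conv_cstl (S : Type) (V W : zmodType) (f : V -> S -> W) u v k :
  (forall a, f 0 a = 0) -> conv f (trunc_cst v) u k = f v (u k).
Proof. by move=> f0; rewrite convC (conv_cstr (f := fun y x => f x y)). Qed.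

Lemma trunc_bil_cst (U V W : lmodType K) (f : {bilinear U -> V -> W}) u v :
  trunc_bil f (trunc_cst u) (trunc_cst v) = trunc_cst (f u v).
Proof.
apply/ffunP => k; rewrite conv_cstr; last by move=> a; rewrite linear0r.
by rewrite !ffunE; case: eqP; rewrite ?linear0l.
Qed.

Lemma trunc_hom_cst (V W : lmodType K) (F : 'I_N.+1 -> {linear V -> W}) v k :
  trunc_hom F (trunc_cst v) k = F k v.
Proof. by rewrite [LHS]conv_cstr // => f; rewrite linear0. Qed.

Lemma conv3_split (W : zmodType) (G : 'I_N.+1 -> 'I_N.+1 -> 'I_N.+1 -> W) :
  \sum_(j < N.+1) \sum_(l < N.+1 | (j + l)%N == N.+1) G ord0 j l +
  \sum_(i < N.+1) \sum_(m < N.+1 | (i + m)%N == N.+1)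
    \sum_(j < N.+1) \sum_(l < N.+1 | (j + l)%N == m) G i j l = conv3 N.+1 G.
Proof.
rewrite /conv3 [X in _ + X = _](bigD1 ord0) //= [RHS](bigD1 ord0) //=.
rewrite [X in _ + (X + _)]big1 ?add0r; last first.
  by move=> m; rewrite add0n ltn_eqF.
congr (_ + _); apply: eq_bigr => i i0.
have lt_m : (N.+1 - i < N.+1)%N.
  by rewrite ltn_subrL lt0n; move: i0; rewrite -val_eqE /= => ->.
have leiN : (i <= N.+1)%N by rewrite ltnW.
rewrite (big_pred1 (Ordinal lt_m)) => [|m] /=.
  apply: eq_bigr => j _; apply: eq_bigl => l /=.
  by rewrite -[LHS](eqn_add2l i) subnKC // addnA.
apply/eqP/eqP => [e|->]; last by rewrite /= subnKC.
by apply/val_inj; rewrite /= -(addKn i m) e.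
Qed.

End Truncation.

Section Deformations.
Variables (K : fieldType) (g : leibnizAlg K) (h : leibnizRep g).
Variable (H : {linear g -> h}).

Definition deformation N (Hs : 'I_N.+1 -> {linear g -> h}) : Prop :=
  Hs ord0 =1 H /\
  @crossed_hom _ (trunc_leibniz N g) (trunc_rep N h) (trunc_hom Hs).

(* The family (H_0, ..., H_N, H'), i.e. H_t + t^{N+1} H'. *)
Definition extend_family N (Hs : 'I_N.+1 -> {linear g -> h})
    (H' : {linear g -> h}) (i : 'I_N.+2) : {linear g -> h} :=
  if unlift ord_max i is Some j then Hs j else H'.

Definition extensible N (Hs : 'I_N.+1 -> {linear g -> h}) : Prop :=
  exists H' : {linear g -> h}, deformation (extend_family Hs H').

Definition brhat (A B : {linear g -> h}) (x y : g) : h :=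
  ⟦A x, B y⟧ + ⟦B x, A y⟧.

Definition obstruction N (Hs : 'I_N.+1 -> {linear g -> h})
    (v : 'I_2 -> g) : h :=
  - (2^-1 *: \sum_(i < N.+1)
      \sum_(j < N.+1 | [&& (0 < i)%N, (0 < j)%N & (i + j)%N == N.+1])
        brhat (Hs i) (Hs j) (v ord0) (v ord_max)).

Definition brsum N (Hs : 'I_N.+1 -> {linear g -> h}) (k : nat) (x y : g) : h :=
  \sum_(i < N.+1) \sum_(j < N.+1 | (i + j)%N == k) ⟦Hs i x, Hs j y⟧.

Lemma deformation_coef N (Hs : 'I_N.+1 -> {linear g -> h}) :
  deformation Hs -> forall (k : 'I_N.+1) x y,
  Hs k ⟦x, y⟧ = rhoL h x (Hs k y) + rhoR h y (Hs k x) + brsum Hs k x y.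
Proof.
move=> [_ cH] k x y.
have /(congr1 (fun v : trunc N h => v k)) := cH (trunc_cst N x) (trunc_cst N y).
have -> : leibniz_br (trunc_leibniz N g) (trunc_cst N x) (trunc_cst N y) =
    trunc_cst N ⟦x, y⟧ by exact: trunc_bil_cst.
rewrite trunc_hom_cst => ->; rewrite !truncDE; congr (_ + _ + _).
- rewrite -[LHS]/(conv (rhoL h) (trunc_cst N x) (trunc_hom Hs (trunc_cst N y)) k).
  by rewrite conv_cstl ?trunc_hom_cst // => a; rewrite linear0l.
- rewrite -[LHS]/(conv (rhoR h) (trunc_cst N y) (trunc_hom Hs (trunc_cst N x)) k).
  by rewrite conv_cstl ?trunc_hom_cst // => a; rewrite linear0l.
rewrite -[LHS]/(conv (@leibniz_br K h) (trunc_hom Hs (trunc_cst N x))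
  (trunc_hom Hs (trunc_cst N y)) k) [LHS]ffunE.
apply: eq_bigr => i _; apply: eq_bigr => j _.
by rewrite !trunc_hom_cst.
Qed.

Lemma obstructionE N (Hs : 'I_N.+1 -> {linear g -> h}) v :
  obstruction Hs v = - (2^-1 * 2) *: brsum Hs N.+1 (v ord0) (v ord_max).
Proof.
rewrite /obstruction scaleNr -scalerA; congr (- (_ *: _)).
rewrite -[2]/(1 + 1) scalerDl scale1r {2}/brsum.
rewrite [X in _ = _ + X](exchange_big_dep predT) //= -big_split.
apply: eq_bigr => i _ /=.
rewrite [X in _ = _ + X](eq_bigl (fun j : 'I_N.+1 => (i + j)%N == N.+1)).
  rewrite -big_split; apply: eq_bigl => j /=.
  case: eqP => [e|]; rewrite ?andbF // andbT.
  case: (posnP i) => [i0|_].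
    by move: e; rewrite i0 add0n => e; move: (ltn_ord j); rewrite e ltnn.
  case: (posnP j) => // j0.
  by move: e; rewrite j0 addn0 => e; move: (ltn_ord i); rewrite e ltnn.
by move=> j; rewrite addnC.
Qed.

Lemma leibniz_delta2E (F : g -> g -> h) (x : 'I_3 -> g) :
  let x0 := x ord0 in let x1 := x (lift ord0 ord0) in let x2 := x ord_max in
  leibniz_delta H (fun v : 'I_2 -> g => F (v ord0) (v ord_max)) x =
    (rhoLH H x0 (F x1 x2) - rhoLH H x1 (F x0 x2) - rhoRH H x2 (F x0 x1))
    + (- F ⟦x0, x1⟧ x2 - F x1 ⟦x0, x2⟧ + F x0 ⟦x1, x2⟧).
Proof.
move=> x0 x1 x2; rewrite {}/x0 {}/x1 {}/x2.
pose y m := x (inord m).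
have -> : x = (fun i => y (val i)) by apply/funext => i; rewrite /y inord_val.
move: y => y {x}; rewrite /leibniz_delta !big_ord_recl !big_ord0 /=.
rewrite !(big_mkcond (fun j : 'I_3 => (_ < j)%N)) /= !big_ord_recl !big_ord0 /=.
rewrite /bump /=.
rewrite !add0r !addr0 expr0 !expr1 !scale1r !scaleN1r.
rewrite -signr_odd /= expr1 -[(-1) ^+ 2]signr_odd /= expr0 scaleN1r scale1r.
by rewrite !addrA.
Qed.

Lemma brsum_multilinear N (Hs : 'I_N.+1 -> {linear g -> h}) k :
  multilinear (fun v : 'I_2 -> g => brsum Hs k (v ord0) (v ord_max)).
Proof.
move=> i v a x y; rewrite /brsum scaler_sumr -big_split; apply: eq_bigr => j _.
rewrite scaler_sumr -big_split; apply: eq_bigr => l _ /=.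
case: i => -[|[|//]] lti /=; first by rewrite linearP linearPl.
by rewrite linearP linearPr.
Qed.

Lemma zmod_cancel (V : zmodType) (P1 P2 X L1 Y r Z Q A R B C : V) :
  (P1 + P2 + X) - (L1 + Y) - (r + Z) + (- (P1 + Q + A) - (P2 + R + B)
    + (Q + L1 + (r + R) + C)) = (X + C) - (Y + B) - (Z + A).
Proof.
rewrite !opprD !addrA.
rewrite [LHS](AC 18 ((1*8)*(2*11)*(4*15)*(6*16)*(9*14)*(12*17)*((3*18)*(5*13)*(7*10)))).
by rewrite /= !subrr !addNr !add0r !addrA.
Qed.

Lemma brsum_cocycle N (Hs : 'I_N.+1 -> {linear g -> h}) :
  deformation Hs ->
  is_cocycle H (fun v : 'I_2 -> g => brsum Hs N.+1 (v ord0) (v ord_max)).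
Proof.
move=> dH_; split; first exact: brsum_multilinear.
apply/funext => x; rewrite /dH leibniz_delta2E.
have coefE := deformation_coef dH_; have H0 := dH_.1.
set x0 := x _; set x1 := x (lift _ _); set x2 := x ord_max.
pose S2 (F : 'I_N.+1 -> 'I_N.+1 -> h) : h :=
  \sum_(i < N.+1) \sum_(j < N.+1 | (i + j)%N == N.+1) F i j.
have S2D F G : S2 (fun i j => F i j + G i j) = S2 F + S2 G.
  by rewrite /S2 -big_split; apply: eq_bigr => i _; rewrite big_split.
have S2N F : S2 (fun i j => - F i j) = - S2 F.
  by rewrite /S2 -sumrN; apply: eq_bigr => i _; rewrite sumrN.
have eqS2 F G : (forall i j, F i j = G i j) -> S2 F = S2 G.
  by move=> e; apply: eq_bigr => i _; apply: eq_bigr => j _; rewrite e.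
have S2C F : S2 F = S2 (fun i j => F j i).
  rewrite /S2 (exchange_big_dep predT) //=; apply: eq_bigr => j _.
  by apply: eq_bigl => i; rewrite addnC.
have S2r (f : h -> h) : linear f -> forall F, f (S2 F) = S2 (fun i j => f (F i j)).
  move=> fL F; pose fl : {linear h -> h} := HB.pack f (GRing.isLinear.Build _ _ _ _ f fL).
  rewrite -[f]/(fl : _ -> _) /S2 raddf_sum; apply: eq_bigr => i _.
  by rewrite raddf_sum.
have S2E p q : brsum Hs N.+1 p q = S2 (fun i j => ⟦Hs i p, Hs j q⟧) by [].
have sumr p (k : nat) q r : ⟦p, brsum Hs k q r⟧ =
    \sum_(i < N.+1) \sum_(j < N.+1 | (i + j)%N == k) ⟦p, ⟦Hs i q, Hs j r⟧⟧.
  by rewrite linear_sumr; apply: eq_bigr => i _; rewrite linear_sumr.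
have suml p (k : nat) q r : ⟦brsum Hs k q r, p⟧ =
    \sum_(i < N.+1) \sum_(j < N.+1 | (i + j)%N == k) ⟦⟦Hs i q, Hs j r⟧, p⟧.
  by rewrite linear_sumlz; apply: eq_bigr => i _; rewrite linear_sumlz.
have splitB p q r : ⟦H p, brsum Hs N.+1 q r⟧ +
    S2 (fun i m => ⟦Hs i p, brsum Hs m q r⟧) =
    conv3 N.+1 (fun i j l => ⟦Hs i p, ⟦Hs j q, Hs l r⟧⟧).
  rewrite -conv3_split -H0 sumr; congr (_ + _).
  by apply: eqS2 => i m; rewrite sumr.
have splitA p q r : ⟦brsum Hs N.+1 p q, H r⟧ +
    S2 (fun m l => ⟦brsum Hs m p q, Hs l r⟧) =
    conv3 N.+1 (fun i j l => ⟦⟦Hs i p, Hs j q⟧, Hs l r⟧).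
  rewrite conv3_swap23 conv3_swap12 -conv3_split -H0 suml; congr (_ + _).
  by rewrite S2C; apply: eqS2 => m l; rewrite suml.
have E01 : brsum Hs N.+1 ⟦x0, x1⟧ x2 =
    S2 (fun i j => ⟦rhoL h x0 (Hs i x1), Hs j x2⟧)
    + S2 (fun i j => ⟦rhoR h x1 (Hs i x0), Hs j x2⟧)
    + S2 (fun i j => ⟦brsum Hs i x0 x1, Hs j x2⟧).
  by rewrite -!S2D; apply: eqS2 => i j; rewrite coefE !linearDl.
have E02 : brsum Hs N.+1 x1 ⟦x0, x2⟧ =
    S2 (fun i j => ⟦Hs i x1, rhoL h x0 (Hs j x2)⟧)
    + S2 (fun i j => ⟦Hs i x1, rhoR h x2 (Hs j x0)⟧)
    + S2 (fun i j => ⟦Hs i x1, brsum Hs j x0 x2⟧).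
  by rewrite -!S2D; apply: eqS2 => i j; rewrite coefE !linearDr.
have L0 : rhoL h x0 (brsum Hs N.+1 x1 x2) =
    S2 (fun i j => ⟦rhoL h x0 (Hs i x1), Hs j x2⟧)
    + S2 (fun i j => ⟦Hs i x1, rhoL h x0 (Hs j x2)⟧).
  rewrite [brsum _ _ _ _]S2E (S2r (rhoL h x0)); last first.
    by move=> a u v; rewrite linearPr.
  by rewrite -S2D; apply: eqS2 => i j; rewrite rep_brL.
have E12 : brsum Hs N.+1 x0 ⟦x1, x2⟧ =
    S2 (fun i j => ⟦rhoR h x1 (Hs i x0), Hs j x2⟧)
    + rhoL h x1 (brsum Hs N.+1 x0 x2)
    + (rhoR h x2 (brsum Hs N.+1 x0 x1)
       + S2 (fun i j => ⟦Hs i x1, rhoR h x2 (Hs j x0)⟧))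
    + S2 (fun i j => ⟦Hs i x0, brsum Hs j x1 x2⟧).
  rewrite !S2E (S2r (rhoL h x1)); last by move=> a u v; rewrite linearPr.
  rewrite (S2r (rhoR h x2)); last by move=> a u v; rewrite linearPr.
  rewrite [S2 (fun i j => ⟦Hs i x1, _⟧)]S2C -!S2D; apply: eqS2 => i j.
  by rewrite coefE !linearDr rep_brLR rep_brR.
have Leib : conv3 N.+1 (fun i j l => ⟦Hs i x0, ⟦Hs j x1, Hs l x2⟧⟧) =
    conv3 N.+1 (fun i j l => ⟦⟦Hs i x0, Hs j x1⟧, Hs l x2⟧) +
    conv3 N.+1 (fun i j l => ⟦Hs i x1, ⟦Hs j x0, Hs l x2⟧⟧).
  rewrite [X in _ = _ + X]conv3_swap12 conv3D; apply: eq_conv3 => i j l.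
  exact: leibniz_id.
rewrite E01 E02 E12 /rhoLH /rhoRH L0 zmod_cancel !splitB splitA Leib.
by rewrite addrK subrr scaler0.
Qed.

Lemma obstruction_cocycle N (Hs : 'I_N.+1 -> {linear g -> h}) :
  deformation Hs -> is_cocycle H (obstruction Hs).
Proof.
move=> /brsum_cocycle[mB dB].
have -> : obstruction Hs = (- (2^-1 * 2)) *:
    (fun v : 'I_2 -> g => brsum Hs N.+1 (v ord0) (v ord_max)) + 0.
  by apply/funext => v; rewrite obstructionE addr0.
split; first by apply: multilinearP => //; exact: multilinear0.
by rewrite dH_linear dB scaler0 dH0 addr0.
Qed.

Definition obstruction_class N (Hs : 'I_N.+1 -> {linear g -> h})
    (defHs : deformation Hs) : cohomology H 2 :=
  cohomology_class (obstruction_cocycle defHs).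

End Deformations.

(* Main.v *)
(** Modulo t^{N+2}, the family H_t + t^{N+1} H' is a crossed homomorphism iff
    each of its coefficients satisfies the crossed homomorphism equation.  In
    degrees at most N these equations only involve H_t, and in degree N+1 the
    equation reads d_H H' = Ob_{H_t}. *)

From HB Require Import structures.
Require Import Defs.
From mathcomp Require Import all_boot all_order all_algebra.
From mathcomp Require Import generic_quotient boolp functions.

Set Implicit Arguments.
Unset Strict Implicit.
Unset Printing Implicit Defensive.

Import GRing.Theory.
Local Open Scope ring_scope.

Lemma cohomology_class_eq0 (K : fieldType) (g : leibnizAlg K) (h : leibnizRep g)
    (H : {linear g -> h}) n (f : ('I_n -> g) -> h) (fZ : is_cocycle H f) :
  cohomology_class fZ = 0 <-> is_coboundary H f.
Proof.
pose I := @coboundary_pred _ _ _ H n.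
(* Zero is written as the class of the zero cocycle, so that equality of classes becomes membership
   of a difference in the subgroup of coboundaries. *)
rewrite /cohomology_class -[0](raddf0 (\pi_(Quotient.quot I)%qT : {additive _ -> _})).
by rewrite (rwP eqP) -Quotient.idealrBE subr0 -(rwP (asboolP _)).
Qed.

Lemma big_ord_recr_cond (V : nmodType) n (P : pred 'I_n.+1) (F : 'I_n.+1 -> V) :
  \sum_(i < n.+1 | P i) F i =
  \sum_(i < n | P (widen_ord (leqnSn n) i)) F (widen_ord (leqnSn n) i)
  + (if P ord_max then F ord_max else 0).
Proof. by rewrite big_mkcond big_ord_recr -big_mkcond. Qed.

Section Deformations.
Variables (K : fieldType) (g : leibnizAlg K) (h : leibnizRep g).

Lemma conv3_brsum N (Hs : 'I_N.+1 -> {linear g -> h}) (x y : trunc N g)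
    (k : 'I_N.+1) :
  conv3 k (fun i j l => brsum Hs i (x j) (y l)) =
  trunc_bil (@leibniz_br K h) (trunc_hom Hs x) (trunc_hom Hs y) k.
Proof.
(* Taking the coefficients of the convolutions to be functions with values in h
   reduces the fourfold sum to the two associativity lemmas for conv. *)
pose B : trunc N (g -> g -> h) :=
  conv (fun (A B : {linear g -> h}) u v => ⟦A u, B v⟧) Hs Hs.
pose C : trunc N (g -> h) :=
  conv (fun u (B : {linear g -> h}) v => ⟦u, B v⟧) (trunc_hom Hs x) Hs.
have BE (i : 'I_N.+1) u v : B i u v = brsum Hs i u v.
  rewrite ffunE /brsum 2!fct_sumE; apply: eq_bigr => a _.
  by rewrite 2!fct_sumE.
have BxE : conv (fun (F : g -> g -> h) u => F u) B x = C.
  apply/ffunP => m; rewrite /C /B /trunc_hom !conv_convl //.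
    by rewrite conv3_swap23.
  by move=> A u v; apply/funext => w; rewrite linearBl.
transitivity (conv (fun (F : g -> h) v => F v) C y k).
  rewrite -BxE conv_convl //; apply: eq_conv3 => i j l; exact/esym/BE.
rewrite /C conv_convl // /trunc_bil /trunc_hom conv_convr //.
by move=> a u v; rewrite linearBr.
Qed.

(** Constant arguments give one direction. Conversely, expanding arbitrary truncated series [x] and
    [y] only produces the coefficient equations at the pairs [x j], [y l], summed over
    [i + j + l = k]. *)
Lemma deformationP (H : {linear g -> h}) N (Hs : 'I_N.+1 -> {linear g -> h}) :
  deformation H Hs <-> Hs ord0 =1 H /\ forall (k : 'I_N.+1) x y,
    Hs k ⟦x, y⟧ = rhoL h x (Hs k y) + rhoR h y (Hs k x) + brsum Hs k x y.
Proof.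
split=> [dHs|[H0 coefE]]; first by split; [exact: dHs.1|exact: deformation_coef dHs].
split=> // x y; apply/ffunP => k; rewrite !truncDE.
(* Every term becomes a [conv3] in which [i] is the degree coming from [Hs] (jointly from both
   factors in the bracket term), so [coefE] applies summand by summand. *)
transitivity (conv3 k (fun i j l => Hs i ⟦x j, y l⟧)).
  by rewrite /= /trunc_hom /trunc_bil conv_convr // => a u v; rewrite linearB.
rewrite -[in RHS]/(trunc_bil (@leibniz_br K h) (trunc_hom Hs x) (trunc_hom Hs y))
  -conv3_brsum.
have -> : rhoL (trunc_rep N h) x (trunc_hom Hs y) k =
    conv3 k (fun i j l => rhoL h (x j) (Hs i (y l))).
  rewrite /= /trunc_hom /trunc_bil conv_convr; last by move=> a u v; rewrite linearBr.
  by rewrite conv3_swap12.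
have -> : rhoR (trunc_rep N h) y (trunc_hom Hs x) k =
    conv3 k (fun i j l => rhoR h (y l) (Hs i (x j))).
  rewrite /= /trunc_hom /trunc_bil conv_convr; last by move=> a u v; rewrite linearBr.
  by rewrite conv3_swap12 conv3_swap23.
by rewrite !conv3D; apply: eq_conv3 => i j l; rewrite coefE.
Qed.

Section Extension.
Variables (N : nat) (Hs : 'I_N.+1 -> {linear g -> h}) (H' : {linear g -> h}).

Lemma extend_family_widen (i : 'I_N.+1) :
  extend_family Hs H' (widen_ord (leqnSn N.+1) i) = Hs i.
Proof.
have -> : widen_ord (leqnSn N.+1) i = lift ord_max i.
  by apply/val_inj; rewrite [RHS]lift_max.
by rewrite /extend_family liftK.
Qed.

Lemma extend_family_max : extend_family Hs H' ord_max = H'.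
Proof. by rewrite /extend_family unlift_none. Qed.

(** Cutting the index N+1 off both sums sorts the brackets by their occurrences of [H']; comparing
    degrees then decides which ones survive. *)
Lemma brsum_extend_family k x y :
  brsum (extend_family Hs H') k x y = brsum Hs k x y
   + \sum_(i < N.+1 | (i + N.+1)%N == k) ⟦Hs i x, H' y⟧
   + \sum_(i < N.+1 | (N.+1 + i)%N == k) ⟦H' x, Hs i y⟧
   + (if (N.+1 + N.+1)%N == k then ⟦H' x, H' y⟧ else 0).
Proof.
rewrite {1}/brsum big_ord_recr /= [X in _ + X = _]big_ord_recr_cond extend_family_max /= addrA.
congr (_ + _ + _); last by under eq_bigr do rewrite extend_family_widen.
rewrite [X in _ = _ + X]big_mkcond -big_split; apply: eq_bigr => i _ /=.
rewrite big_ord_recr_cond extend_family_max extend_family_widen /=.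
by under eq_bigr do rewrite extend_family_widen.
Qed.

(** Every bracket containing [H'] has degree at least N+1. *)
Lemma brsum_extend_family_low (k : 'I_N.+1) x y :
  brsum (extend_family Hs H') k x y = brsum Hs k x y.
Proof.
have out i : ((N.+1 + i)%N == k) = false.
  by apply/negbTE; rewrite neq_ltn orbC (leq_trans (ltn_ord k)) ?leq_addr.
rewrite brsum_extend_family out !big_pred0 ?addr0 // => i.
by rewrite addnC out.
Qed.

(** In degree N+1 the map [H'] can pair only with the coefficient of index 0; its bracket with
    itself has degree 2N+2, which is too large. *)
Lemma brsum_extend_family_top x y :
  brsum (extend_family Hs H') N.+1 x y =
  brsum Hs N.+1 x y + ⟦Hs ord0 x, H' y⟧ + ⟦H' x, Hs ord0 y⟧.
Proof.
have addE i : ((N.+1 + i)%N == N.+1) = (i == 0%N).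
  by rewrite -{2}[N.+1]addn0 eqn_add2l.
rewrite brsum_extend_family addE addr0.
by rewrite !(big_pred1 ord0) // => i /=; rewrite 1?[(i + _)%N]addnC addE.
Qed.

(** Since [Hs ord0] is [H], the two brackets pairing it with [H'] turn the actions in the top
    equation into the twisted ones [rhoLH] and [rhoRH]. *)
Lemma deformation_extend_family (H : {linear g -> h}) :
  deformation H Hs ->
  deformation H (extend_family Hs H') <-> forall x y,
    rhoLH H x (H' y) + rhoRH H y (H' x) - H' ⟦x, y⟧ = - brsum Hs N.+1 x y.
Proof.
move=> dHs; have H0 := dHs.1; have coefE := deformation_coef dHs.
have topE x y : rhoL h x (H' y) + rhoR h y (H' x)
    + brsum (extend_family Hs H') N.+1 x y =
    rhoLH H x (H' y) + rhoRH H y (H' x) + brsum Hs N.+1 x y.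
  rewrite brsum_extend_family_top /rhoLH /rhoRH !H0.
  by rewrite [X in _ = X + _]addrACA -[RHS]addrA [X in _ = _ + X]addrC !addrA.
have eqE x y :
    rhoLH H x (H' y) + rhoRH H y (H' x) - H' ⟦x, y⟧ = - brsum Hs N.+1 x y <->
    H' ⟦x, y⟧ = rhoL h x (H' y) + rhoR h y (H' x)
      + brsum (extend_family Hs H') N.+1 x y.
  rewrite topE; split=> [/eqP|->]; last by rewrite opprD addrA subrr add0r.
  by rewrite subr_eq [- _ + _]addrC -subr_eq opprK => /eqP.
split=> [/deformationP[_ cE] x y|cE].
  by apply/eqE; have := cE ord_max x y; rewrite extend_family_max.
apply/deformationP; split=> [x|k x y].
  have -> : ord0 = widen_ord (leqnSn N.+1) (ord0 : 'I_N.+1) by exact/val_inj.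
  by rewrite extend_family_widen H0.
(* Up to degree N the equation is inherited from [Hs]; the only other degree is N+1. *)
have [ltk|] := ltnP k N.+1.
  have -> : k = widen_ord (leqnSn N.+1) (Ordinal ltk) by exact/val_inj.
  rewrite extend_family_widen (brsum_extend_family_low (Ordinal ltk)).
  exact: coefE.
rewrite leq_eqVlt ltnNge -ltnS ltn_ord orbF => /eqP Nk.
have -> : k = ord_max by exact/val_inj.
by rewrite extend_family_max; apply/eqE.
Qed.

End Extension.

(** On 1-cochains the global sign is +1, and the result has the shape of the left-hand side in
    [deformation_extend_family]. *)
Lemma dH1E (H : {linear g -> h}) (c : ('I_1 -> g) -> h) (v : 'I_2 -> g) :
  dH H c v =
    rhoLH H (v ord0) (c (fun=> v ord_max))
    + rhoRH H (v ord_max) (c (fun=> v ord0))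
    - c (fun=> ⟦v ord0, v ord_max⟧).
Proof.
(* Omitting one of two arguments leaves exactly the other one. *)
have ordE (i j : 'I_2) (k : 'I_1) : i != j -> lift i k = j.
  by case: i j k => -[|[|//]] ? [[|[|//]] ?] [[|//] ?] // _; exact/val_inj.
rewrite /dH /leibniz_delta !big_ord_recl !big_ord0.
rewrite !(big_mkcond (fun j : 'I_2 => (_ < j)%N)) !big_ord_recl !big_ord0 /=.
rewrite !(addr0, add0r) sqrrN expr1n !scale1r expr1 scaleN1r.
have -> : widen_ord (leqnSn 1) ord0 = ord0 by exact/val_inj.
congr (rhoLH H _ (c _) + rhoRH H _ (c _) - c _); apply/funext => k.
- by rewrite (ordE _ ord_max).
- by rewrite (ordE _ ord0).
by rewrite !(ordE ord0 ord_max) // eqxx.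
Qed.

(** Characteristic 0 makes 2 invertible, so the factor [2^-1 * 2] is 1. *)
Lemma obstruction_brsum (charK : [pchar K] =i pred0) N
    (Hs : 'I_N.+1 -> {linear g -> h}) v :
  obstruction Hs v = - brsum Hs N.+1 (v ord0) (v ord_max).
Proof.
rewrite obstructionE mulVf ?scaleN1r //.
by have := charK 2; rewrite !inE /= => /negbT.
Qed.

End Deformations.

Theorem theorem4p14 (K : fieldType) (charK : [pchar K] =i pred0)
    (g : leibnizAlg K) (h : leibnizRep g)
    (H : {linear g -> h}) (crossH : crossed_hom H)
    (N : nat) (Hs : 'I_N.+1 -> {linear g -> h}) (defHs : deformation H Hs) :
  extensible H Hs <-> obstruction_class defHs = 0.
Proof.
rewrite /obstruction_class; apply: (iff_trans _ (iff_sym (cohomology_class_eq0 _))).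
split=> [[H' /(deformation_extend_family H' defHs) eqH']|[c cL dc]].
  (* The extending map itself, read as a 1-cochain, is the primitive of the obstruction. *)
  exists (fun v => H' (v ord0)).
    by move=> i v a u w; rewrite !ord1 /= linearP.
  by apply/funext => v; rewrite dH1E eqH' obstruction_brsum.
(* Conversely, a primitive [c] gives the new coefficient; a 1-tuple is a constant function, so
   linearity of [c1] is multilinearity of [c] in its only slot. *)
pose c1 y := c (fun=> y).
have c1L : linear c1.
  move=> a u w; have upd y : (fun=> y) = [eta (fun=> 0 : g) with (ord0 : 'I_1) |-> y].
    by apply/funext => i; rewrite /= ord1.
  by have := cL ord0 (fun=> 0) a u w; rewrite -!upd.
pose H' : {linear g -> h} := HB.pack c1 (GRing.isLinear.Build _ _ _ _ c1 c1L).
exists H'; apply/(deformation_extend_family H' defHs) => x y.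
have /(congr1 (fun f => f (fun i : 'I_2 => if i == ord0 then x else y))) := dc.
by rewrite dH1E obstruction_brsum.
Qed.
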